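(* Let $G$ be a non-trivial finite group. Then $G$ is $\psi$-divisible if and only if its $\psi$-divisibility graph $\psi_G$ has a universal vertex.
   Context: For a finite group $G$, $\psi(G)=\sum_{x\in G}o(x)$, where $o(x)$ is the order of $x$. A finite group $G$ is called $\psi$-divisible if $\psi(H)\mid\psi(G)$ for every subgroup $H$ of $G$. For a non-trivial finite group $G$, the $\psi$-divisibility graph $\psi_G$ is the simple undirected graph whose vertices are the non-trivial subgroups of $G$ (all subgroups of $G$, including $G$ itself, except the trivial subgroup $\{1\}$), in which two distinct vertices $H$ and $K$ are adjacent if and only if ($H\subset K$ and $\psi(H)\mid\psi(K)$) or ($K\subset H$ and $\psi(K)\mid\psi(H)$). A universal (dominating) vertex of a graph is a vertex adjacent to every other vertex. *)

(* Defs.v *)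
From HB Require Import structures.
From mathcomp Require Import all_boot all_fingroup.
Set Implicit Arguments.
Unset Strict Implicit.
Unset Printing Implicit Defensive.

Local Open Scope group_scope.

Definition universal_vertex (V : finType) (e : rel V) (v : V) : Prop :=
  forall w : V, w != v -> e v w.

Section Psi.
Variable gT : finGroupType.
Implicit Types G : {group gT}.

Definition psi (A : {set gT}) : nat := (\sum_(x in A) #[x])%N.

Definition psi_divisible G : Prop :=
  forall H : {group gT}, H \subset G -> psi H %| psi G.

Definition nontrivial_subgroup G : finType :=
  {H : {group gT} | (H \subset G) && (H :!=: 1)}.

Definition psi_adj G : rel (nontrivial_subgroup G) := fun u v =>
  let H : {group gT} := sval u in
  let K : {group gT} := sval v in
  (u != v) && ((H \subset K) && (psi H %| psi K)
            || (K \subset H) && (psi K %| psi H)).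

Lemma psi_adj_irrefl G : irreflexive (@psi_adj G).
Proof. by move=> u; rewrite /psi_adj eqxx. Qed.

Lemma psi_adj_sym G : symmetric (@psi_adj G).
Proof. by move=> u v; rewrite /psi_adj eq_sym orbC. Qed.

End Psi.

(* Main.v *)
Require Import Defs.
From HB Require Import structures.
From mathcomp Require Import all_boot all_fingroup all_solvable.
Set Implicit Arguments.
Unset Strict Implicit.
Unset Printing Implicit Defensive.

Local Open Scope group_scope.

(** If [G] is psi-divisible then [G] is a universal vertex, by definition.
    Conversely, every universal vertex [H] is equal to [G], and then its
    universality is psi-divisibility ([psi] is 1 on the trivial subgroup).

    Suppose indeed that [H] is proper. Being comparable with all cyclic
    subgroups, [H] lies inside [<[x]>], and [psi H] divides [psi <[x]>], for
    every [x] in [G :\: H]. Take such an [x] of least order. A power [x ^+ p]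
    with [p] a prime divisor of [#[x]] has smaller order, hence is in [H]; two
    such primes would put [x] itself in [H], so [x] is a p-element, and so [H]
    is a nontrivial p-group with [<[x ^+ p]> \subset H \proper <[x]>].
    Writing [#[x] = m * #|H|], this says [1 < m <= p]. By minimality every
    element of [<[x]> :\: H] has order [#[x]], whence
      [psi <[x]> = psi H + (m - 1) * #|H| * #[x]].
    As [H] is a p-group, [psi H] is 1 modulo [p], hence coprime to the p-powers
    [#|H|] and [#[x]]; so [psi H] divides [m - 1]. This is absurd, since
    [psi H >= #|H| >= p >= m] ([no_proper_comparable_divisor]). *)

Section PsiFacts.

Variable gT : finGroupType.
Implicit Types (G H K : {group gT}) (x : gT).

Lemma psi1 : psi [1 gT] = 1%N.
Proof. by rewrite /psi big_set1 order1. Qed.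

Lemma leq_card_psi (A : {set gT}) : #|A| <= psi A.
Proof. by rewrite -sum1_card; apply: leq_sum => x _; apply: order_gt0. Qed.

Lemma psi_setD H K : H \subset K -> psi K = (psi H + psi (K :\: H))%N.
Proof. by move=> sHK; rewrite /psi (big_setID H) (setIidPr sHK). Qed.

(** The identity contributes 1 to the sum, and every other element of a
    p-group contributes a multiple of [p]. *)
Lemma coprime_psi_pgroup (p : nat) H : prime p -> p.-group H -> coprime p (psi H).
Proof.
move=> p_pr pH; rewrite (psi_setD (sub1G H)) psi1.
suff /dvdnP[k ->] : p %| psi (H :\: 1) by rewrite /coprime addnC gcdnMDl gcdn1.
apply: dvdn_sum => x /setD1P[ntx Hx].
have [n ox] := p_natP (mem_p_elt pH Hx).
by rewrite ox; case: n ox => [/eqP|n _]; rewrite ?order_eq1 ?(negPf ntx) // expnS dvdn_mulr.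
Qed.

Lemma expg_coprime_mem H x m n :
  0 < m -> coprime m n -> x ^+ m \in H -> x ^+ n \in H -> x \in H.
Proof.
move=> m_gt0 /eqP co_mn Hxm Hxn.
have [k l def_km _] := egcdnP n m_gt0.
have: x ^+ (k * m) \in H by rewrite mulnC expgM groupX.
by rewrite def_km co_mn expgD expg1 mulnC expgM groupMl // groupX.
Qed.

Lemma ltn_order_expg x p : prime p -> p %| #[x] -> #[x ^+ p] < #[x].
Proof.
by move=> p_pr p_x; rewrite orderXdiv // ltn_Pdiv ?order_gt0 ?prime_gt1.
Qed.

(** All [x ^+ p], for [p] a prime divisor of [#[x]], lie in [H], so by
    Bezout there is at most one such prime. *)
Lemma min_order_p_elt H x :
    x \notin H ->
    (forall y, y \in <[x]> -> y \notin H -> #[x] <= #[y]) ->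
  exists p : nat, [/\ prime p, p.-elt x & x ^+ p \in H].
Proof.
move=> H'x minx.
have HXx p : prime p -> p %| #[x] -> x ^+ p \in H.
  move=> p_pr p_x; apply: contraLR (ltn_order_expg p_pr p_x).
  by rewrite -leqNgt; apply: minx; apply: mem_cycle.
have x_gt1 : 1 < #[x] by rewrite order_gt1; apply: contraNneq H'x => ->.
exists (pdiv #[x]); split; rewrite ?HXx ?pdiv_prime ?pdiv_dvd //.
apply/pnatP=> [|q q_pr q_x]; first exact: order_gt0.
apply: contraR H'x => p'q.
apply: (@expg_coprime_mem _ _ q (pdiv #[x]));
  rewrite ?prime_gt0 ?HXx ?pdiv_prime ?pdiv_dvd //.
by rewrite prime_coprime // dvdn_prime2 ?pdiv_prime.
Qed.

Lemma no_proper_comparable_divisor G H :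
    H :!=: 1 -> H \proper G ->
    (forall x, x \in G :\: H -> H \subset <[x]> /\ psi H %| psi <[x]>) ->
  False.
Proof.
move=> ntH /properP[sHG [x0 Gx0 H'x0]] sHcycle.
have Dx0 : x0 \in G :\: H by apply/setDP.
case: (arg_minnP (fun x => #[x]) Dx0) => x Dx minx.
have [sHx dvd_psi] := sHcycle x Dx.
have /setDP[Gx H'x] := Dx.
have min_cyc y : y \in <[x]> -> y \notin H -> #[x] <= #[y].
  move=> xy H'y; apply: minx.
  by apply/setDP; rewrite (subsetP _ y xy) ?cycle_subG.
have [p [p_pr px Hxp]] := min_order_p_elt H'x min_cyc.
have p_x : p %| #[x].
  have ntx : x != 1 by apply: contraNneq H'x => ->.
  by have [] := pgroup_pdiv px; rewrite // cycle_eq1.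
have pH : p.-group H := pgroupS sHx px.
have psi_diff : psi (<[x]> :\: H) = ((#[x] - #|H|) * #[x])%N.
  have <- : #|<[x]> :\: H| = (#[x] - #|H|)%N by rewrite cardsD (setIidPr sHx).
  rewrite -sum_nat_const /psi; apply: eq_bigr => y /setDP[xy H'y].
  by apply/eqP; rewrite eqn_leq dvdn_leq ?order_gt0 ?order_dvdG ?min_cyc.
have /dvdnP[m ox] : #|H| %| #[x] := cardSg sHx.
have m_gt1 : 1 < m.
  rewrite ltnNge; apply: contra H'x => m_le1.
  rewrite -cycle_subG -(geq_leqif (subset_leqif_card sHx)) -orderE ox.
  by rewrite -[leqRHS]mul1n leq_mul2r m_le1 orbT.
(* <[x ^+ p]> has index p in <[x]>, and it is contained in H. *)
have m_le_p : m <= p.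
  have : #[x ^+ p] <= #|H| by rewrite subset_leq_card ?cycle_subG.
  by rewrite orderXdiv // leq_divLR // ox mulnC leq_pmul2l.
have p_le_H : p <= #|H|.
  have [_ p_H _] := pgroup_pdiv pH ntH.
  by rewrite dvdn_leq.
have co_psi n : p.-nat n -> coprime (psi H) n.
  case/p_natP=> k ->; rewrite coprime_sym coprimeXl //.
  exact: coprime_psi_pgroup.
have dvd_psi_m : psi H %| m.-1.
  move: dvd_psi; rewrite (psi_setD sHx) dvdn_addr // psi_diff.
  rewrite (Gauss_dvdl _ (co_psi _ px)) ox -[X in _ - X]mul1n -mulnBl subn1.
  by rewrite (Gauss_dvdl _ (co_psi _ pH)).
have psi_lt_m : psi H < m.
  by rewrite -(ltn_predK m_gt1) ltnS dvdn_leq // -ltnS (ltn_predK m_gt1).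
have := leq_trans psi_lt_m (leq_trans m_le_p (leq_trans p_le_H (leq_card_psi H))).
by rewrite ltnn.
Qed.

(** Only the nontrivial cyclic subgroups [<[x]>] with [x] outside the
    universal vertex have to be tested. *)
Lemma universal_vertex_eq G (v : nontrivial_subgroup G) :
  universal_vertex (@psi_adj gT G) v -> sval v = G.
Proof.
case: v => H /= sHG_ntH univH; have /andP[sHG ntH] := sHG_ntH.
apply/val_inj/eqP; rewrite eqEproper sHG /=; apply/negP=> pHG.
apply: (no_proper_comparable_divisor ntH pHG) => x /setDP[Gx H'x].
have sxG_ntx : (<[x]>%G \subset G) && (<[x]>%G :!=: 1).
  by rewrite /= cycle_subG Gx cycle_eq1; apply: contraNneq H'x => ->.
have nsxH : ~~ (<[x]> \subset H) by rewrite cycle_subG.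
have /univH : exist _ <[x]>%G sxG_ntx != exist _ H sHG_ntH :> nontrivial_subgroup G.
  by apply: contraNneq nsxH => /(congr1 sval)/= <-.
by case/andP=> _ /= /orP[/andP[]|/andP[sxH]] //; rewrite sxH in nsxH.
Qed.

End PsiFacts.

Theorem theorem2p10 (gT : finGroupType) (G : {group gT}) (G_neq1 : G :!=: 1) :
  psi_divisible G <->
  exists H : nontrivial_subgroup G, universal_vertex (@psi_adj gT G) H.
Proof.
have sGG_ntG : (G \subset G) && (G :!=: 1) by rewrite subxx.
split=> [divG | [v univ_v] K sKG].
  exists (exist _ G sGG_ntG) => -[K sKG_ntK] neqKG.
  have /andP[sKG _] := sKG_ntK.
  by rewrite /psi_adj eq_sym neqKG /= sKG divG ?orbT.
have defG := universal_vertex_eq univ_v.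
have [-> | ntK] := eqVneq (K : {set gT}) 1; first by rewrite psi1 dvd1n.
have [-> // | neqKG] := eqVneq K G.
have sKG_ntK : (K \subset G) && (K :!=: 1) by rewrite sKG.
have /univ_v : exist _ K sKG_ntK != v :> nontrivial_subgroup G.
  by apply: contraNneq neqKG => /(congr1 sval)/= ->; rewrite defG.
rewrite /psi_adj defG => /andP[_ /= /orP[/andP[sGK _]|/andP[]//]].
by case/eqP: neqKG; apply/val_inj/eqP; rewrite eqEsubset sKG.
Qed.
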